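(* Let $n\ge 3$ and let $p,q>1$ satisfy $\frac{1}{p+1}+\frac{1}{q+1}>\frac{n-2}{n}$. Let $K,Q\in C^1(\mathbb{R}^n)$ and assume that there are positive constants $\alpha,\beta,C,M$ such that $\alpha\le K(x)\le\beta$ and $\alpha\le Q(x)\le\beta$ for all $x\in\mathbb{R}^n$, and $|\nabla K(x)|,|\nabla Q(x)|\le Ce^{M|x|}$ for all $x\in\mathbb{R}^n$ with $|x|$ large. Then the ground energy function $\Sigma:\mathbb{R}^n\to\mathbb{R}$ (defined in the context) is locally Lipschitz continuous on $\mathbb{R}^n$.
   Context: Let $\mathcal{H}=L^{\frac{p+1}{p}}(\mathbb{R}^n)\times L^{\frac{q+1}{q}}(\mathbb{R}^n)$. Let $T_1:L^{\frac{q+1}{q}}(\mathbb{R}^n)\to W^{2,\frac{q+1}{q}}(\mathbb{R}^n)\hookrightarrow L^{p+1}(\mathbb{R}^n)$ and $T_2:L^{\frac{p+1}{p}}(\mathbb{R}^n)\to W^{2,\frac{p+1}{p}}(\mathbb{R}^n)\hookrightarrow L^{q+1}(\mathbb{R}^n)$ both be given by $(-\Delta+\mathrm{Id})^{-1}$, and for $\eta=(\eta_1,\eta_2)\in\mathcal{H}$ put $\langle T\eta,\eta\rangle=\eta_1T_1\eta_2+\eta_2T_2\eta_1$ (a function on $\mathbb{R}^n$). For $z\in\mathbb{R}^n$ define $I_z:\mathcal{H}\to\mathbb{R}$ by $$I_z(\eta)=\frac{p}{p+1}\int_{\mathbb{R}^n}\frac{|\eta_1|^{\frac{p+1}{p}}}{Q^{\frac1p}(z)}+\frac{q}{q+1}\int_{\mathbb{R}^n}\frac{|\eta_2|^{\frac{q+1}{q}}}{K^{\frac1q}(z)}-\frac12\int_{\mathbb{R}^n}\langle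 T\eta,\eta\rangle .$$ Let $\mathcal{N}_z=\{\eta\in\mathcal{H}:\eta\ne(0,0),\ I_z'(\eta)[\eta]=0\}$ be its Nehari manifold. The ground energy function is $\Sigma(z)=\inf_{\eta\in\mathcal{N}_z}I_z(\eta)$. *)

(* Defs.v *)
From HB Require Import structures.
From mathcomp Require Import all_boot all_order all_algebra.
From mathcomp Require Import all_classical all_reals all_analysis.

Set Implicit Arguments.
Unset Strict Implicit.
Unset Printing Implicit Defensive.
Import Order.TTheory GRing.Theory Num.Theory.
Import numFieldNormedType.Exports.

Local Open Scope classical_set_scope.
Local Open Scope ring_scope.

(** [R^n] is ['rV[R]_n] with the sigma-algebra generated by the coordinates,
    which is also the Borel sigma-algebra. *)

Definition measure_rV_display : measure_display.
Proof. exact: default_measure_display. Qed.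

Section measurable_rV.
Context {R : realType} (n : nat).

Let coord (i : 'I_n) (x : 'rV[R]_n) : measurableTypeR R := x ord0 i.

Let rV_set0 : g_sigma_preimage coord set0.
Proof. exact: sigma_algebra0. Qed.

Let rV_setC A : g_sigma_preimage coord A -> g_sigma_preimage coord (~` A).
Proof. exact: sigma_algebraC. Qed.

Let rV_bigcup (F : (set 'rV[R]_n)^nat) :
  (forall i, g_sigma_preimage coord (F i)) ->
  g_sigma_preimage coord (\bigcup_i (F i)).
Proof. exact: sigma_algebra_bigcup. Qed.

HB.instance Definition _ := @isMeasurable.Build measure_rV_display
  'rV[R]_n (g_sigma_preimage coord) rV_set0 rV_setC rV_bigcup.

Lemma measurable_coord (i : 'I_n) :
  measurable_fun [set: 'rV[R]_n]
    (fun x : 'rV[R]_n => x ord0 i : measurableTypeR R).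
Proof.
move=> _ Y mY; rewrite setTI; apply: sub_sigma_algebra => /=.
rewrite -bigcup_seq/=; exists i => /=; first by rewrite mem_index_enum.
by exists Y => //; rewrite setTI.
Qed.

Lemma measurable_fun_coordP d (T : measurableType d) (f : T -> 'rV[R]_n) :
  (forall i, measurable_fun [set: T]
     (fun x => f x ord0 i : measurableTypeR R)) ->
  measurable_fun [set: T] f.
Proof.
move=> mf; pose G : set (set 'rV[R]_n) := [set A | measurable (f @^-1` A)].
suff H : (measurable : set (set 'rV[R]_n)) `<=` G.
  by move=> _ Y /H; rewrite setTI.
apply: smallest_sub.
  split=> [|A mA|F mF]; rewrite /G /=.
  - by rewrite preimage_set0.
  - by rewrite setTD preimage_setC; exact: measurableC.
  - by rewrite preimage_bigcup; apply: bigcup_measurable => k _; exact: mF.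
move=> A; rewrite -bigcup_seq/= => -[i _ [Y mY <-]].
by rewrite /G /= setTI; have := mf i measurableT Y mY; rewrite setTI.
Qed.

End measurable_rV.

Section cons_rV.
Context {R : realType} (n : nat).

Definition cons_rV (u : measurableTypeR R * 'rV[R]_n) : 'rV[R]_n.+1 :=
  \row_i (if unlift ord0 i is Some j then u.2 ord0 j else u.1).

Definition uncons_rV (x : 'rV[R]_n.+1) : measurableTypeR R * 'rV[R]_n :=
  (x ord0 ord0, \row_j x ord0 (lift ord0 j)).

Lemma cons_rVK : cancel cons_rV uncons_rV.
Proof.
case=> a v; rewrite /uncons_rV /cons_rV; congr pair.
  by rewrite mxE unlift_none.
by apply/rowP => j; rewrite !mxE liftK.
Qed.

Lemma measurable_cons_rV : measurable_fun setT cons_rV.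
Proof.
apply: measurable_fun_coordP => i.
have -> : (fun u => cons_rV u ord0 i : measurableTypeR R) =
  (fun u => if unlift ord0 i is Some j then u.2 ord0 j else u.1).
  by apply/funext => u; rewrite mxE.
case: (unlift ord0 i) => [j|]; last exact: measurable_fst.
exact: (measurableT_comp (measurable_coord j) measurable_snd).
Qed.

Lemma measurable_uncons_rV : measurable_fun setT uncons_rV.
Proof.
apply: measurable_fun_pair; first exact: measurable_coord.
apply: measurable_fun_coordP => j.
under eq_fun do rewrite mxE.
exact: measurable_coord.
Qed.

Variable mu : {sigma_finite_measure set 'rV[R]_n -> \bar R}.

Definition lebesgue_cons : set 'rV[R]_n.+1 -> \bar R :=
  pushforward (@lebesgue_measure R \x mu)%E cons_rV.


Let lebesgue_cons_measure : {measure set 'rV[R]_n.+1 -> \bar R} :=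
  measure_function_pushforward__canonical__measure_function_Measure
    (@lebesgue_measure R \x mu)%E measurable_cons_rV.

Let lebesgue_cons0 : lebesgue_cons set0 = 0%E.
Proof. exact: (measure0 lebesgue_cons_measure). Qed.

Let lebesgue_cons_ge0 A : (0 <= lebesgue_cons A)%E.
Proof. exact: (measure_ge0 lebesgue_cons_measure). Qed.

Let lebesgue_cons_sigma_additive : semi_sigma_additive lebesgue_cons.
Proof. exact: (@measure_semi_sigma_additive _ _ _ lebesgue_cons_measure). Qed.

HB.instance Definition _ := isMeasure.Build _ _ _ lebesgue_cons
  lebesgue_cons0 lebesgue_cons_ge0 lebesgue_cons_sigma_additive.

Let lebesgue_cons_sigma_finite : sigma_finite setT lebesgue_cons.
Proof.
have /sigma_finiteP[F [TF ndF Foo]] := sigma_finiteT (@lebesgue_measure R).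
have /sigma_finiteP[G [TG ndG Goo]] := sigma_finiteT mu.
exists (fun k => uncons_rV @^-1` (F k `*` G k)).
  rewrite -preimage_bigcup (_ : \bigcup_k (F k `*` G k) = setT)//.
  apply/seteqP; split=> // -[x y] _.
  have [k _ Fkx] : (\bigcup_i F i) x by rewrite -TF.
  have [l _ Gly] : (\bigcup_i G i) y by rewrite -TG.
  exists (maxn k l) => //; split.
  - by move: x Fkx; exact/subsetPset/ndF/leq_maxl.
  - by move: y Gly; exact/subsetPset/ndG/leq_maxr.
move=> k; have [mFk Fk] := Foo k; have [mGk Gk] := Goo k; split.
  rewrite -[X in measurable X]setTI; apply: measurable_uncons_rV => //.
  exact: measurableX.
rewrite /lebesgue_cons /pushforward -comp_preimage.
rewrite (_ : uncons_rV \o cons_rV = id); last first.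
  by apply/funext => u; exact: cons_rVK.
by rewrite preimage_id product_measure1E// lte_mul_pinfty// ge0_fin_numE.
Qed.

HB.instance Definition _ := Measure_isSigmaFinite.Build _ _ _ lebesgue_cons
  lebesgue_cons_sigma_finite.

End cons_rV.

Fixpoint lebesgue_rV {R : realType} (n : nat) :
    {sigma_finite_measure set 'rV[R]_n -> \bar R} :=
  match n with
  | 0 => \d_(0 : 'rV[R]_0)
  | n'.+1 => lebesgue_cons (lebesgue_rV n')
  end.

Section calculus.
Context {R : realType} {n : nat}.
Implicit Types (f : 'rV[R]_n -> R) (x : 'rV[R]_n).

(** The library norm on ['rV[R]_n] is the sup norm, not this one. *)
Definition euclid_norm x : R := Num.sqrt (\sum_(i < n) x ord0 i ^+ 2).

Definition basis_rV (i : 'I_n) : 'rV[R]_n := delta_mx ord0 i.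

Definition gradient f x : 'rV[R]_n := \row_i 'D_(basis_rV i) f x.

Definition C1 f : Prop :=
  (forall x, differentiable f x) /\ continuous (gradient f).

Definition iter_partial (s : seq 'I_n) f : 'rV[R]_n -> R :=
  foldr (fun i g x => 'D_(basis_rV i) g x) f s.

Definition test_function f : Prop :=
  (forall s x, differentiable (iter_partial s f) x) /\
  compact (closure [set x | f x != 0]).

End calculus.

(** Elements of [LfunType] are functions, not classes: equality in [L^r] is
    [= %[ae _]]. *)

Section resolvent.
Context {R : realType} (n : nat) (r : R) (r1 : (1 <= r%:E)%E).
Let mu := @lebesgue_rV R n.
Local Notation Lr := (LfunType mu r1).

Definition weak_derivative (s : seq 'I_n) (u v : Lr) : Prop :=
  forall phi : 'rV[R]_n -> R, test_function phi ->
    \int[mu]_x (u x * iter_partial s phi x) =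
    (-1) ^+ size s * \int[mu]_x (v x * phi x).

Definition sobolev (k : nat) (u : Lr) : Prop :=
  forall s : seq 'I_n, (size s <= k)%N -> exists v, weak_derivative s u v.

(** The graph of [-Laplacian + Id : W^{2,r} -> L^r]. *)
Definition helmholtz (u f : Lr) : Prop :=
  sobolev 2 u /\
  exists d2 : 'I_n -> Lr,
    (forall i, weak_derivative [:: i; i] u (d2 i)) /\
    (f : _ -> R) = (fun x => - (\sum_(i < n) d2 i x) + u x) %[ae mu].

Definition inverse_helmholtz (T : Lr -> Lr) : Prop :=
  (forall f, helmholtz (T f) f) /\
  (forall u f, helmholtz u f -> (T f : _ -> R) = u %[ae mu]).

(** For [1 < r < oo], [-Laplacian + Id] is a bijection from [W^{2,r}] onto
    [L^r] (Calderon-Zygmund), so an inverse exists; it is unique up to a.e.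
    equality, and the default value [0] is never used. *)
Definition resolvent : Lr -> Lr := xget (fun=> 0) [set T | inverse_helmholtz T].

End resolvent.

Section energy.
Context {R : realType} (n : nat) (p q : R).

Lemma conjugate_exponent_ge1 (a : R) : 1 < a -> (1 <= ((a + 1) / a)%:E)%E.
Proof.
move=> a1; have a0 : 0 < a by rewrite (lt_trans ltr01).
by rewrite lee_fin ler_pdivlMr// mul1r lerDl.
Qed.

Hypotheses (hp : 1 < p) (hq : 1 < q).
Variables (K Q : 'rV[R]_n -> R).
Let mu := @lebesgue_rV R n.

Definition energy_space : lmodType R :=
  (LfunType mu (conjugate_exponent_ge1 hp) *
   LfunType mu (conjugate_exponent_ge1 hq))%type.

(** The embeddings of [W^{2,(q+1)/q}] into [L^{p+1}] and of [W^{2,(p+1)/p}] into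
    [L^{q+1}] leave the function unchanged, so they do not appear. *)
Definition T_1 := @resolvent R n _ (conjugate_exponent_ge1 hq).
Definition T_2 := @resolvent R n _ (conjugate_exponent_ge1 hp).

Definition pairing (eta : energy_space) (x : 'rV[R]_n) : R :=
  eta.1 x * T_1 eta.2 x + eta.2 x * T_2 eta.1 x.

Definition I_ (z : 'rV[R]_n) (eta : energy_space) : R :=
  p / (p + 1) * \int[mu]_x (`|eta.1 x| `^ ((p + 1) / p) / Q z `^ p^-1) +
  q / (q + 1) * \int[mu]_x (`|eta.2 x| `^ ((q + 1) / q) / K z `^ q^-1) -
  2^-1 * \int[mu]_x pairing eta x.

(** [has_dderivative J eta xi l] means [J'(eta)[xi] = l]. *)
Definition has_dderivative (J : energy_space -> R) (eta xi : energy_space)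
    (l : R) : Prop :=
  is_derive (0 : R) (1 : R) (fun t : R => J (eta + t *: xi)) l.

Definition nehari (z : 'rV[R]_n) : set energy_space :=
  [set eta : energy_space |
     ~ ((eta.1 : _ -> R) = cst 0 %[ae mu] /\
        (eta.2 : _ -> R) = cst 0 %[ae mu]) /\
     has_dderivative (I_ z) eta eta 0].

Definition ground_energy (z : 'rV[R]_n) : R :=
  inf [set I_ z eta | eta in nehari z].

End energy.

(* Main.v *)
(* Write u = Q(z)^(-1/p), v = K(z)^(-1/q), X and Y for the integrals of
   |eta_1|^((p+1)/p) and |eta_2|^((q+1)/q), and P for the integral of <T eta, eta>.
   Since T is homogeneous, I_z(s eta) is an explicit function of s > 0, and eta
   lies on the Nehari manifold iff u X + v Y = P; there I_z is a combination of
   u X and v Y with nonnegative coefficients. Both exponents are below 2, so if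
   u and v change by factors in [1/lam, lam], some s in [lam^-N, lam^N] brings
   s eta to the new manifold, at an energy at most lam^(2N) times the old one.
   Hence Sigma(z') <= lam^(2N) Sigma(z), and lam = 1 + O(|z - z'|) locally because
   K and Q are C^1 and bounded away from 0. *)

Require Import Defs.
From mathcomp Require Import all_boot all_order all_algebra.
From mathcomp Require Import ring lra.
From mathcomp Require Import all_classical all_reals all_analysis.
From mathcomp Require Import measurable_realfun.

Set Implicit Arguments.
Unset Strict Implicit.
Unset Printing Implicit Defensive.
Import Order.TTheory GRing.Theory Num.Theory.
Import numFieldNormedType.Exports.

Local Open Scope classical_set_scope.
Local Open Scope ring_scope.

(** * Positive constants and integrals *)

Section positive_scaling.
Local Open Scope ereal_scope.
Context d (T : measurableType d) (R : realType).
Variable mu : {measure set T -> \bar R}.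

(** The integral is a supremum over simple functions below [f]; [k] times such a function competes
    in the supremum for [k * f]. *)
Lemma ge0_le_integral_scale (k : R) (f : T -> \bar R) : (0 < k)%R ->
  (forall x, 0 <= f x) -> k%:E * \int[mu]_x f x <= \int[mu]_x (k%:E * f x).
Proof.
move=> k0 f0; rewrite !ge0_integralTE//; last first.
  by move=> x; rewrite mule_ge0// lee_fin ltW.
rewrite -lee_pdivlMl//; apply: ub_ereal_sup => _ [h hf <-].
rewrite lee_pdivlMl//; apply: ereal_sup_ubound.
exists (scale_nnsfun h (ltW k0)); last exact: sintegralrM.
by move=> x /=; rewrite EFinM lee_pmul2l// lte_fin.
Qed.

(** The missing inequality is the previous lemma for [k^-1] and [k * f]. *)
Lemma ge0_integral_scale (k : R) (f : T -> \bar R) : (0 < k)%R ->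
  (forall x, 0 <= f x) -> \int[mu]_x (k%:E * f x) = k%:E * \int[mu]_x f x.
Proof.
move=> k0 f0; apply/eqP; rewrite eq_le ge0_le_integral_scale// andbT.
rewrite -lee_pdivrMl// (_ : \int[mu]_x f x =
    \int[mu]_x (k^-1%:E * (k%:E * f x))); last first.
  apply: eq_integral => x _.
  by rewrite muleA -EFinM mulVf ?gt_eqF// mul1e.
apply: ge0_le_integral_scale; first by rewrite invr_gt0.
by move=> x; rewrite mule_ge0// lee_fin ltW.
Qed.

(** A positive real factor fixes both infinities, so even the conventional value of oo - oo is
    respected. *)
Lemma gt0_muleBr (k : R) (x y : \bar R) : (0 < k)%R ->
  k%:E * (x - y) = k%:E * x - k%:E * y.
Proof.
move=> k0; have ky : k%:E * +oo = +oo by rewrite gt0_muley// lte_fin.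
have kNy : k%:E * -oo = -oo by rewrite gt0_muleNy// lte_fin.
by case: x => [a||]; case: y => [b||]; rewrite /= ?ky ?kNy//= -EFinM mulrBr.
Qed.

Lemma gt0_fineM (k : R) (x : \bar R) : (0 < k)%R ->
  fine (k%:E * x) = (k * fine x)%R.
Proof.
move=> k0; case: x => [a||] //=.
- by rewrite gt0_muley ?lte_fin//= mulr0.
- by rewrite gt0_muleNy ?lte_fin//= mulr0.
Qed.

(* Unlike [RintegralZl], this needs neither measurability nor integrability:
   positive and negative parts scale separately. *)
Lemma Rintegral_scale (k : R) (f : T -> R) : (0 < k)%R ->
  (\int[mu]_x (k * f x) = k * \int[mu]_x f x)%R.
Proof.
move=> k0; rewrite /Rintegral.
have -> : \int[mu]_x (k * f x)%:E = k%:E * \int[mu]_x (f x)%:E.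
  rewrite [in LHS]integralE [in RHS]integralE.
  rewrite (_ : (fun x => (k * f x)%:E) = (fun x => k%:E * (f x)%:E)); last first.
    by apply/funext => x; rewrite EFinM.
  rewrite ge0_funeposM ?(ltW k0)// ge0_funenegM ?(ltW k0)//.
  rewrite !ge0_integral_scale//.
  by rewrite -gt0_muleBr.
exact: gt0_fineM.
Qed.

End positive_scaling.

(** * Rescaling onto a neighbouring Nehari manifold *)

Section nehari_scaling.
Context {R : realType}.
Implicit Types a b s lam u v X Y P : R.

(** As N(2 - a) is at least 1, lam <= lam^(N(2 - a)): the gap between the exponents [a] and 2
    absorbs one factor [lam]. *)
Lemma powR_expr_gap a lam (N : nat) : 1 <= lam -> 1 <= N%:R * (2 - a) ->
  lam * (lam ^+ N) `^ a <= (lam ^+ N) ^+ 2.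
Proof.
move=> lam1 Na; have lam0 : 0 < lam by rewrite (lt_le_trans ltr01).
have L0 : 0 < lam ^+ N by rewrite exprn_gt0.
rewrite -(powR_mulrn 2 (ltW L0)) -[X in _ <= _ `^ X](subrK a).
rewrite powRD; last by apply/implyP; rewrite (gt_eqF L0).
rewrite ler_wpM2r ?powR_ge0// -(powR_mulrn N (ltW lam0)) -powRrM.
by rewrite -{1}(powRr1 (ltW lam0)) ler_powR.
Qed.

(* [s] is a zero of the difference of the two sides, found by the intermediate
   value theorem between [lam ^- N] and [lam ^+ N]. *)
Lemma nehari_scaling a b lam (N : nat) u u' v v' X Y P :
  0 < a -> 0 < b -> 1 <= N%:R * (2 - a) -> 1 <= N%:R * (2 - b) -> 1 <= lam ->
  0 < u -> 0 < u' -> 0 < v -> 0 < v' -> 0 <= X -> 0 <= Y ->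
  u <= lam * u' -> u' <= lam * u -> v <= lam * v' -> v' <= lam * v ->
  u * X + v * Y = P ->
  exists s, [/\ 0 < s, u' * (s `^ a * X) + v' * (s `^ b * Y) = s ^+ 2 * P,
    u' * s `^ a <= (lam ^+ N) ^+ 2 * u & v' * s `^ b <= (lam ^+ N) ^+ 2 * v].
Proof.
move=> a0 b0 Na Nb lam1 u0 u'0 v0 v'0 X0 Y0 uu' u'u vv' v'v XYP.
have lam0 : 0 < lam by rewrite (lt_le_trans ltr01).
set L := lam ^+ N; have L1 : 1 <= L by rewrite exprn_ege1.
have L0 : 0 < L by rewrite (lt_le_trans ltr01).
(* At [s = L] the quadratic side dominates, term by term. *)
have up c w w' : 1 <= N%:R * (2 - c) -> 0 < w -> w' <= lam * w ->
    w' * L `^ c <= L ^+ 2 * w.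
  move=> Nc w0 w'w; apply: le_trans (_ : lam * w * L `^ c <= _).
    by rewrite ler_wpM2r ?powR_ge0.
  by rewrite mulrAC ler_wpM2r ?(ltW w0)// powR_expr_gap.
(* At [s = L^-1] the order is reversed: clearing denominators gives [up] with [w] and [w']
   exchanged. *)
have down c w w' : 1 <= N%:R * (2 - c) -> 0 < w -> 0 < w' -> w <= lam * w' ->
    L^-1 ^+ 2 * w <= w' * L^-1 `^ c.
  move=> Nc w0 w'0 ww'.
  have -> : L^-1 `^ c = (L `^ c)^-1.
    by rewrite -(powR_inv1 (ltW L0)) -powRrM mulN1r powRN.
  rewrite exprVn.
  rewrite ler_pdivlMr ?powR_gt0// -mulrA ler_pdivrMl ?exprn_gt0//.
  exact: up.
pose f s := u' * X * s `^ a + v' * Y * s `^ b - P * s ^+ 2.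
have f_up : f L <= 0.
  rewrite /f subr_le0 -XYP mulrDl lerD//.
  - by have := up _ _ _ Na u0 u'u; move/(ler_wpM2r X0); nra.
  - by have := up _ _ _ Nb v0 v'v; move/(ler_wpM2r Y0); nra.
have f_down : 0 <= f L^-1.
  rewrite /f subr_ge0 -XYP mulrDl lerD//.
  - by have := down _ _ _ Na u0 u'0 uu'; move/(ler_wpM2r X0); nra.
  - by have := down _ _ _ Nb v0 v'0 vv'; move/(ler_wpM2r Y0); nra.
have Vgt0 : 0 < L^-1 by rewrite invr_gt0.
have LL : L^-1 <= L by rewrite (le_trans _ L1)// invf_le1.
have [||s] := @IVT R f L^-1 L 0 LL.
- apply: derivable_within_continuous => x; rewrite in_itv/= => /andP[xL _].
  have x0 : 0 < x by rewrite (lt_le_trans Vgt0).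
  apply: derivableB; last by apply: derivableM => //; exact: exprn_derivable.
  by apply: derivableD; apply: derivableM => //;
    apply: derivable_powR; rewrite in_itv/= andbT.
- by rewrite ge_min f_up orbT/= le_max f_down.
rewrite in_itv/= => /andP[sL Ls] fs; have s0 : 0 < s by rewrite (lt_le_trans Vgt0).
exists s; split => //.
- by move: fs; rewrite /f => /eqP; rewrite subr_eq0 => /eqP E; nra.
(* Since [s <= L], the left side is at most its value at [L], which [up] bounds. *)
- apply: le_trans (up _ _ _ Na u0 u'u); rewrite ler_wpM2l ?(ltW u'0)//.
  by rewrite ge0_ler_powR// ?nnegrE ltW.
- apply: le_trans (up _ _ _ Nb v0 v'v); rewrite ler_wpM2l ?(ltW v'0)//.
  by rewrite ge0_ler_powR// ?nnegrE ltW.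
Qed.

End nehari_scaling.

(** * Local Lipschitz bounds for C^1 functions *)

Section C1_lipschitz.
Context {R : realType} (n : nat).

Lemma diff_gradient (f : 'rV[R]_n -> R) (x v : 'rV[R]_n) : differentiable f x ->
  'd f x v = \sum_(i < n) v ord0 i * gradient f x ord0 i.
Proof.
move=> df; rewrite [in LHS](row_sum_delta v) linear_sum; apply: eq_bigr => i _.
by rewrite linearZ /= mxE deriveE.
Qed.

Lemma ler_coord_norm (v : 'rV[R]_n) i : `|v ord0 i| <= `|v|.
Proof.
rewrite [leRHS]mx_normrE.
exact: (le_bigmax _ (fun k : 'I_1 * 'I_n => `|v k.1 k.2|) (ord0, i)).
Qed.

Lemma norm_diff_gradient (f : 'rV[R]_n -> R) (x v : 'rV[R]_n) :
  differentiable f x -> `|'d f x v| <= n%:R * (`|gradient f x| * `|v|).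
Proof.
move=> df; rewrite diff_gradient//; apply: (le_trans (ler_norm_sum _ _ _)).
rewrite -[X in X%:R * _]card_ord -sum1_card natr_sum mulr_suml.
apply: ler_sum => i _; rewrite mul1r normrM mulrC.
by rewrite ler_pM// ler_coord_norm.
Qed.

(** Mean value theorem on the segment from [y] to [x], with the gradient bounded near [z] by
    continuity. Allowing every small radius lets [K] and [Q] share one ball later. *)
Lemma C1_lipschitz (f : 'rV[R]_n -> R) (z : 'rV[R]_n) : C1 f ->
  exists2 L : R, 0 <= L & \forall e \near 0^'+,
  forall x y, ball z e x -> ball z e y -> `|f x - f y| <= L * `|x - y|.
Proof.
move=> [df cg]; exists (n%:R * (`|gradient f z| + 1)).
  by rewrite mulr_ge0// addr_ge0.
have /nbhs_ballP[d /= d0 Hd] : \forall x \near z, `|gradient f z - gradient f x| < 1.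
  by have /cvgrPdist_lt := cg z; apply.
near=> e => x y zx zy.
have Hg t : 0 <= t <= 1 -> `|gradient f (y + t *: (x - y))| <= `|gradient f z| + 1.
  move=> /andP[t0 t1]; rewrite -lerBlDl (le_trans (lerB_dist _ _))// distrC ltW//.
  apply: Hd; apply: (@le_ball _ _ _ e).
    by near: e; apply: nbhs_right_le.
  move: zx zy; rewrite -!ball_normE /=.
  have -> : z - (y + t *: (x - y)) = t *: (z - x) + (1 - t) *: (z - y).
    by rewrite !scalerBr !scalerBl !scale1r; apply/rowP => i; rewrite !mxE; ring.
  move=> zx zy; apply: le_lt_trans (ler_normD _ _) _; rewrite !normrZ.
  rewrite (ger0_norm t0) ger0_norm ?subr_ge0//.
  (* For [t > 0] the strict inequality comes from [x]; for [t = 0] only [y] can supply it. *)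
  have [->|t0'] := eqVneq t 0; first by rewrite mul0r add0r subr0 mul1r.
  have tp : 0 < t by rewrite lt_neqAle eq_sym t0'.
  nra.
have dh (t : R) : is_derive t 1 (fun t : R => f (y + t *: (x - y)))
    ('d f (y + t *: (x - y)) (x - y)).
  have dg : is_diff t (fun t : R => y + t *: (x - y)) (fun h => 0 + h *: (x - y)).
    exact: is_diffD.
  have dfx := differentiableP (df (y + t *: (x - y))).
  have [dfg] := is_diff_comp dg dfx.
  move=> fgE; split; first exact/derivable1_diffP.
  by rewrite deriveE// fgE /= add0r scale1r.
have [|t tI] := @MVT_segment R (fun t => f (y + t *: (x - y)))
    (fun t => 'd f (y + t *: (x - y)) (x - y)) 0 1 ler01.
  by apply: derivable_within_continuous => t _; exact: ex_derive.
rewrite scale1r scale0r addr0 subr0 mulr1 (_ : y + (x - y) = x) ?subrKC// => ->.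
apply: le_trans (norm_diff_gradient _ (df _)) _.
rewrite -mulrA ler_wpM2l// ler_wpM2r//; apply: Hg.
by move: tI; rewrite in_itv.
Unshelve. all: by end_near. Qed.
End C1_lipschitz.

(** * Homogeneity of the resolvent *)

Section resolvent_homogeneous.
Context {R : realType} (n : nat) (r : R) (r1 : (1 <= r%:E)%E).
Let mu := @lebesgue_rV R n.
Local Notation Lr := (LfunType mu r1).

Lemma weak_derivative_scale (k : R) s (u v : Lr) : 0 < k ->
  weak_derivative s u v -> weak_derivative s (k *: u) (k *: v).
Proof.
move=> k0 uv phi tphi; have := uv phi tphi => /(congr1 ( *%R k)).
rewrite mulrCA -!(Rintegral_scale _ _ k0) => E.
rewrite (_ : (fun x => _) = (fun x => k * (u x * iter_partial s phi x))); last first.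
  by apply/funext => x; rewrite mulrA.
rewrite [in LHS]E; congr (_ * Rintegral _ _ _).
by apply/funext => x; rewrite mulrA.
Qed.

Lemma helmholtz_scale (k : R) (u f : Lr) : 0 < k ->
  helmholtz u f -> helmholtz (k *: u) (k *: f).
Proof.
move=> k0 [su [d2 [wd ae]]]; split.
  by move=> s /su[v uv]; exists (k *: v); exact: weak_derivative_scale.
exists (fun i => k *: d2 i); split.
  by move=> i; exact: weak_derivative_scale.
apply: filterS ae => x /(_ I) fx _ /=.
change (k * f x = - (\sum_(i < n) k * d2 i x) + k * u x).
by rewrite fx mulrDr mulrN mulr_sumr.
Qed.

(* Homogeneity comes from the uniqueness clause of [inverse_helmholtz]; the
   default value [0] of [resolvent] is homogeneous as well, so existence of the
   inverse is not an issue. *)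
Lemma resolvent_scale (k : R) (f : Lr) : 0 < k ->
  (resolvent (k *: f) : _ -> R) = (fun x => k * resolvent f x) %[ae mu].
Proof.
move=> k0; rewrite /resolvent.
case: xgetP => [T _ [T1 T2]|_].
  exact: (T2 (k *: T f) _ (helmholtz_scale k0 (T1 f))).
by apply: aeW => x _; rewrite [RHS]mulr0.
Qed.

End resolvent_homogeneous.

(** * Energy on the Nehari manifold and comparison of ground energies *)

Section nehari_manifold.
Context {R : realType} (n : nat) (p q : R).
Hypotheses (hp : 1 < p) (hq : 1 < q).
Variables (K Q : 'rV[R]_n -> R).
Hypotheses (K_gt0 : forall z, 0 < K z) (Q_gt0 : forall z, 0 < Q z).
Let mu := @lebesgue_rV R n.
Local Notation H := (energy_space n hp hq).
Local Notation J := (@I_ R n p q hp hq K Q).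
Local Notation Ne := (@nehari R n p q hp hq K Q).
Local Notation Sigma := (@ground_energy R n p q hp hq K Q).
Let a := (p + 1) / p.
Let b := (q + 1) / q.
Let X (eta : H) := \int[mu]_x (`|eta.1 x| `^ a).
Let Y (eta : H) := \int[mu]_x (`|eta.2 x| `^ b).
Let P (eta : H) := \int[mu]_x pairing eta x.
Let u z := (Q z `^ p^-1)^-1.
Let v z := (K z `^ q^-1)^-1.

Let p0 : 0 < p. Proof. exact: lt_trans hp. Qed.
Let q0 : 0 < q. Proof. exact: lt_trans hq. Qed.
Let u_gt0 z : 0 < u z. Proof. by rewrite invr_gt0 powR_gt0. Qed.
Let v_gt0 z : 0 < v z. Proof. by rewrite invr_gt0 powR_gt0. Qed.
(** For [r = p] and [r = q] these are the coefficients of the energy on the Nehari manifold. *)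
Let half (r : R) : 1 < r -> 0 <= r / (r + 1) - 2^-1.
Proof.
move=> r1; have r10 : 0 < r + 1 by rewrite addr_gt0// (lt_trans ltr01).
by rewrite subr_ge0 ler_pdivlMr//; lra.
Qed.
Let X_ge0 eta : 0 <= X eta.
Proof. by apply: Rintegral_ge0 => x _; exact: powR_ge0. Qed.
Let Y_ge0 eta : 0 <= Y eta.
Proof. by apply: Rintegral_ge0 => x _; exact: powR_ge0. Qed.

Lemma Rintegral_powR_scale (r : R) (r1 : (1 <= r%:E)%E) (s c : R)
    (f : LfunType (@lebesgue_rV R n) r1) : 0 < s ->
  \int[@lebesgue_rV R n]_x (`|(s *: f) x| `^ c) =
  s `^ c * \int[@lebesgue_rV R n]_x (`|f x| `^ c).
Proof.
move=> s0; rewrite -Rintegral_scale ?powR_gt0//; congr (Rintegral _ _ _).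
apply/funext => x; have -> : (s *: f) x = s * f x by [].
by rewrite normrM (gtr0_norm s0) powRM// ltW.
Qed.

Let X_scale s eta : 0 < s -> X (s *: eta) = s `^ a * X eta.
Proof. by move=> s0; rewrite /X -[(s *: eta).1]/(s *: eta.1) Rintegral_powR_scale. Qed.

Let Y_scale s eta : 0 < s -> Y (s *: eta) = s `^ b * Y eta.
Proof. by move=> s0; rewrite /Y -[(s *: eta).2]/(s *: eta.2) Rintegral_powR_scale. Qed.

(** One factor [s] comes from [eta], the other from the resolvent. The latter is homogeneous only
    almost everywhere, hence the passage through [ae_eq_integral]. *)
Lemma Rintegral_pairing_scale (s : R) (eta : H) : 0 < s -> P (s *: eta) = s ^+ 2 * P eta.
Proof.
move=> s0; rewrite /P -Rintegral_scale ?exprn_gt0//; congr fine.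
have mpair (e : H) : measurable_fun setT (pairing e).
  by apply: measurable_funD; apply: measurable_funM.
apply: ae_eq_integral => //.
- by apply/measurable_EFinP; exact: mpair.
- by apply/measurable_EFinP; apply: measurable_funM.
apply: filterS2 (resolvent_scale eta.2 s0) (resolvent_scale eta.1 s0) => x.
move=> /(_ I) E2 /(_ I) E1 _ /=.
have {}E1 : T_2 (s *: eta.1) x = s * T_2 eta.1 x := E1.
have {}E2 : T_1 (s *: eta.2) x = s * T_1 eta.2 x := E2.
congr EFin; rewrite /pairing -[(s *: eta).1]/(s *: eta.1) -[(s *: eta).2]/(s *: eta.2).
rewrite E1 E2.
have -> : (s *: eta.1) x = s * eta.1 x by [].
have -> : (s *: eta.2) x = s * eta.2 x by [].
ring.
Qed.

Lemma I_E z eta : J z eta =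
  p / (p + 1) * (u z * X eta) + q / (q + 1) * (v z * Y eta) - 2^-1 * P eta.
Proof.
rewrite /I_; congr (_ * _ + _ * _ - _); rewrite -Rintegral_scale//;
  congr (Rintegral _ _ _); by apply/funext => x; rewrite mulrC.
Qed.

(** For [t] near 0 the argument is [(1 + t) *: eta] with [1 + t > 0], so the scaling laws give the
    explicit function [g]. The prefactors of [I_] cancel the exponents [a], [b] and 2. *)
Lemma is_derive_I z eta : is_derive (0 : R) (1 : R)
  (fun t : R => J z (eta + t *: eta)) (u z * X eta + v z * Y eta - P eta).
Proof.
pose g (t : R) := p / (p + 1) * (u z * ((1 + t) `^ a * X eta)) +
  q / (q + 1) * (v z * ((1 + t) `^ b * Y eta)) - 2^-1 * ((1 + t) ^+ 2 * P eta).
apply: (@near_eq_is_derive _ _ _ g).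
  near=> t; have t0 : 0 < 1 + t.
    by rewrite -ltrBlDl sub0r; near: t; apply: lt_nbhsr; rewrite ltrN10.
  have -> : eta + t *: eta = (1 + t) *: eta by rewrite scalerDl scale1r.
  by rewrite I_E X_scale// Y_scale// Rintegral_pairing_scale.
have dpow c : is_derive (0 : R) 1 (fun t : R => (1 + t) `^ c) c.
  have dpow1 : is_derive (1 + 0 : R) 1 (fun t : R => t `^ c) (c * (1 + 0) `^ (c - 1)).
    by apply: is_derive1_powR; rewrite addr0.
  have dadd : is_derive (0 : R) 1 (fun t : R => 1 + t) 1.
    have := is_deriveD (is_derive_cst (1 : R) (0 : R) (1 : R)) (is_derive_id (0 : R) 1).
    by rewrite add0r.
  have := is_derive1_comp dpow1 dadd; rewrite addr0 powR1 !mulr1.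
  by [].
have da := dpow a; have db := dpow b.
rewrite /g; apply: is_derive_eq.
rewrite !scaler0 !addr0 !add0r /GRing.scale /= /a /b.
have p10 : p + 1 != 0 by rewrite gt_eqF// addr_gt0.
have q10 : q + 1 != 0 by rewrite gt_eqF// addr_gt0.
by field; rewrite p10 q10 !gt_eqF.
Unshelve. all: by end_near. Qed.

Lemma nehari_conditionP z eta :
  has_dderivative (J z) eta eta 0 <-> u z * X eta + v z * Y eta = P eta.
Proof.
split=> [D|E].
  have /@derive_val := is_derive_I z eta; rewrite (@derive_val _ _ _ _ _ _ _ D).
  by move/esym/eqP; rewrite subr_eq0 => /eqP.
by have := is_derive_I z eta; rewrite E subrr.
Qed.

Lemma I_nehari z eta : Ne z eta -> J z eta =
  (p / (p + 1) - 2^-1) * (u z * X eta) + (q / (q + 1) - 2^-1) * (v z * Y eta).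
Proof. by move=> [_ /nehari_conditionP E]; rewrite I_E -E; ring. Qed.

Lemma nehari_transfer lam (N : nat) z z' eta : 1 <= lam ->
  1 <= N%:R * (2 - a) -> 1 <= N%:R * (2 - b) ->
  Q z <= lam * Q z' -> Q z' <= lam * Q z ->
  K z <= lam * K z' -> K z' <= lam * K z ->
  Ne z eta -> exists2 eta', Ne z' eta' &
    J z' eta' <= (lam ^+ N) ^+ 2 * J z eta.
Proof.
move=> lam1 Na Nb QQ' Q'Q KK' K'K Nzeta.
have [nz /nehari_conditionP E] := Nzeta.
have lam0 : 0 < lam by rewrite (lt_le_trans ltr01).
(* As 1/r < 1 and [lam >= 1], taking roots keeps the ratio within [lam]; this passes the bounds on
   [Q] and [K] to [u] and [v]. *)
have root (r x y : R) : 1 < r -> 0 < x -> 0 < y -> y <= lam * x ->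
    (x `^ r^-1)^-1 <= lam * (y `^ r^-1)^-1.
  move=> r1 x0 y0 yx; have r0 : 0 < r := lt_trans ltr01 r1.
  rewrite ler_pdivlMr ?powR_gt0// mulrC ler_pdivrMr ?powR_gt0//.
  apply: (@le_trans _ _ ((lam * x) `^ r^-1)).
    by rewrite ge0_ler_powR// ?nnegrE ?invr_ge0 ?ltW// mulr_gt0.
  rewrite powRM ?(ltW lam0) ?(ltW x0)// ler_wpM2r ?powR_ge0// -[leRHS](powRr1 (ltW lam0)).
  by rewrite ler_powR// invf_le1// ltW.
have a0 : 0 < a by rewrite divr_gt0// addr_gt0.
have b0 : 0 < b by rewrite divr_gt0// addr_gt0.
have [s [s0 Es us vs]] := nehari_scaling a0 b0 Na Nb lam1 (u_gt0 z) (u_gt0 z')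
  (v_gt0 z) (v_gt0 z') (X_ge0 eta) (Y_ge0 eta) (root _ _ _ hp (Q_gt0 _) (Q_gt0 _) Q'Q)
  (root _ _ _ hp (Q_gt0 _) (Q_gt0 _) QQ') (root _ _ _ hq (K_gt0 _) (K_gt0 _) K'K)
  (root _ _ _ hq (K_gt0 _) (K_gt0 _) KK') E.
have Nz'eta : Ne z' (s *: eta).
  split; last first.
    by apply/nehari_conditionP; rewrite X_scale// Y_scale// Rintegral_pairing_scale.
  move=> [e1 e2]; apply: nz.
  have sK r (r1 : (1 <= r%:E)%E) (f : LfunType mu r1) :
      (s *: f : _ -> R) = cst 0 %[ae mu] -> (f : _ -> R) = cst 0 %[ae mu].
    apply: filterS => x /(_ I) sf _; move: sf; have -> : (s *: f) x = s * f x by [].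
    by move/eqP; rewrite mulf_eq0 gt_eqF//= => /eqP.
  by split; apply: sK; [exact: e1|exact: e2].
exists (s *: eta) => //.
(* With [P] eliminated, [us] and [vs] compare the energies term by term. *)
rewrite (I_nehari Nz'eta) (I_nehari Nzeta) X_scale// Y_scale// mulrDr.
by apply: lerD; rewrite [leRHS]mulrCA ler_wpM2l ?half// !mulrA ler_wpM2r ?X_ge0 ?Y_ge0.
Qed.

Lemma I_nehari_ge0 z eta : Ne z eta -> 0 <= J z eta.
Proof.
by move=> /I_nehari ->; rewrite addr_ge0// !mulr_ge0// ?half// ltW.
Qed.

Lemma ground_energy_ge0 z : 0 <= Sigma z.
Proof.
have [[eta Neta]|N0] := pselect (Ne z !=set0).
  apply: lb_le_inf; first by exists (J z eta); exists eta.
  by move=> _ [xi Nxi <-]; exact: I_nehari_ge0.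
(* The infimum of the empty set is 0 by convention. *)
rewrite /ground_energy (_ : Ne z = set0) ?image_set0 ?inf0//.
by apply/seteqP; split=> // eta Neta; apply: N0; exists eta.
Qed.

Lemma ground_energy_le lam (N : nat) z z' : 1 <= lam ->
  1 <= N%:R * (2 - a) -> 1 <= N%:R * (2 - b) ->
  Q z <= lam * Q z' -> Q z' <= lam * Q z ->
  K z <= lam * K z' -> K z' <= lam * K z ->
  Sigma z' <= (lam ^+ N) ^+ 2 * Sigma z.
Proof.
move=> lam1 Na Nb QQ' Q'Q KK' K'K.
have lam0 : 0 < lam by rewrite (lt_le_trans ltr01).
have [[eta Neta]|N0] := pselect (Ne z !=set0); last first.
  (* The hypotheses are symmetric in [z] and [z'], so an empty manifold at [z] forces one at [z'],
     and both infima are 0. *)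
  rewrite /ground_energy (_ : Ne z' = set0).
    by rewrite image_set0 inf0 mulr_ge0 ?exprn_ge0 ?(ltW lam0)// ground_energy_ge0.
  apply/seteqP; split=> // eta Neta; apply: N0.
  by have [eta' Neta' _] := nehari_transfer lam1 Na Nb Q'Q QQ' K'K KK' Neta; exists eta'.
rewrite -ler_pdivrMl ?exprn_gt0//; apply: lb_le_inf.
  by exists (J z eta); exists eta.
move=> _ [xi Nxi <-]; rewrite ler_pdivrMl ?exprn_gt0//.
have [xi' Nxi'] := nehari_transfer lam1 Na Nb QQ' Q'Q KK' K'K Nxi.
apply: le_trans; apply: ge_inf; last by exists xi'.
by exists 0 => _ [zeta Nzeta <-]; exact: I_nehari_ge0.
Qed.

End nehari_manifold.

(** By convexity the power lies below its chord on [0, 1]. This turns the multiplicative comparison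
    of ground energies into a bound linear in the distance. *)
Lemma chord_expr_1D {R : realFieldType} (L t : R) (m : nat) : 0 <= L -> 0 <= t <= 1 ->
  (1 + L * t) ^+ m - 1 <= t * ((1 + L) ^+ m - 1).
Proof.
move=> L0 /andP[t0 t1]; elim: m => [|m IH]; first by rewrite !expr0 subrr mulr0.
rewrite !exprSr; set c := (1 + L) ^+ m in IH *; set d := (1 + L * t) ^+ m in IH *.
have c1 : 1 <= c by rewrite exprn_ege1// lerDl.
have Lt : 0 <= L * t by rewrite mulr_ge0.
have dL : (d - 1) * (L * t) <= t * (c - 1) * (L * t) by rewrite ler_wpM2r.
have : t * (c - 1) * (L * t) <= (c - 1) * (L * t).
  by rewrite ler_wpM2r// ler_piMl// subr_ge0.
nra.
Qed.

(** * From multiplicative comparison to a Lipschitz bound *)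

Theorem theorem2p1 (R : realType) (n : nat) (hn : (3 <= n)%N)
    (p q : R) (hp : 1 < p) (hq : 1 < q)
    (hpq : (n%:R - 2) / n%:R < 1 / (p + 1) + 1 / (q + 1))
    (K Q : 'rV[R]_n -> R) (K_C1 : C1 K) (Q_C1 : C1 Q)
    (alpha beta C M : R)
    (alpha_gt0 : 0 < alpha) (beta_gt0 : 0 < beta) (C_gt0 : 0 < C) (M_gt0 : 0 < M)
    (K_bound : forall x, alpha <= K x <= beta)
    (Q_bound : forall x, alpha <= Q x <= beta)
    (gradK_bound : exists rho : R, forall x, rho <= euclid_norm x ->
       euclid_norm (gradient K x) <= C * expR (M * euclid_norm x))
    (gradQ_bound : exists rho : R, forall x, rho <= euclid_norm x ->
       euclid_norm (gradient Q x) <= C * expR (M * euclid_norm x)) :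
  forall z : 'rV[R]_n, exists2 U : set 'rV[R]_n,
    nbhs z U & [lipschitz (ground_energy hp hq K Q) x | x in U].

Proof.
have K_gt0 x : 0 < K x by have /andP[/(lt_le_trans alpha_gt0)] := K_bound x.
have Q_gt0 x : 0 < Q x by have /andP[/(lt_le_trans alpha_gt0)] := Q_bound x.
have Sigma_ge0 := ground_energy_ge0 hp hq K_gt0 Q_gt0.
move=> z.
have [N [Na Nb]] : exists N : nat, 1 <= N%:R * (2 - (p + 1) / p) /\
    1 <= N%:R * (2 - (q + 1) / q).
  (* Stated for all larger [k], so that the maximum serves both exponents. *)
  have gap (r : R) : 1 < r -> exists N : nat,
      forall k, (N <= k)%N -> 1 <= k%:R * (2 - (r + 1) / r).
    move=> r1; have r0 : 0 < r := lt_trans ltr01 r1.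
    have g0 : 0 < 2 - (r + 1) / r by rewrite subr_gt0 ltr_pdivrMr//; lra.
    exists (Num.bound (2 - (r + 1) / r)^-1) => k Nk.
    rewrite -ler_pdivrMr// div1r; apply/ltW/(lt_le_trans (archi_boundP _)).
      by rewrite invr_ge0 ltW.
    by rewrite ler_nat.
  have [Np HNp] := gap _ hp; have [Nq HNq] := gap _ hq.
  by exists (maxn Np Nq); split; [apply: HNp|apply: HNq];
    rewrite ?leq_maxl ?leq_maxr.
have [LK LK0 HK] := C1_lipschitz z K_C1.
have [LQ LQ0 HQ] := C1_lipschitz z Q_C1.
(* Dividing by the lower bound [alpha] makes additive increments of [K] and [Q] relative ones. *)
pose L := (LK + LQ) / alpha.
have L0 : 0 <= L by rewrite divr_ge0 ?addr_ge0// ltW.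
(* Radius at most 1/2 keeps distances within the ball at most 1, as [chord_expr_1D] requires. *)
have [e [e0 e1 {}HK {}HQ]] : exists e : R, [/\ 0 < e, e <= 2^-1,
    forall x y, ball z e x -> ball z e y -> `|K x - K y| <= LK * `|x - y| &
    forall x y, ball z e x -> ball z e y -> `|Q x - Q y| <= LQ * `|x - y|].
  near (0 : R)^'+ => e; exists e; split; near: e => //.
  - exact: nbhs_right_gt.
  - by apply: nbhs_right_le; rewrite invr_gt0.
have scale (F : 'rV[R]_n -> R) LF x y : 0 <= LF -> LF <= LK + LQ ->
    alpha <= F y -> `|F x - F y| <= LF * `|x - y| -> F x <= (1 + L * `|x - y|) * F y.
  move=> LF0 LFL Fy /ler_normlW; rewrite lerBlDl => /le_trans; apply.
  rewrite mulrDl mul1r lerD2l mulrAC ler_wpM2r// /L mulrAC ler_pdivlMr//.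
  by rewrite ler_pM// ltW.
have LKL : LK <= LK + LQ by rewrite lerDl.
have LQL : LQ <= LK + LQ by rewrite lerDr.
pose m := (N * 2)%N; pose S := ground_energy hp hq K Q.
have compare x y : ball z e x -> ball z e y -> S x <= (1 + L * `|x - y|) ^+ m * S y.
  move=> zx zy; have /andP[Kx _] := K_bound x; have /andP[Ky _] := K_bound y.
  have /andP[Qx _] := Q_bound x; have /andP[Qy _] := Q_bound y.
  rewrite exprM; apply: ground_energy_le => //.
  - by rewrite lerDl mulr_ge0.
  - by rewrite distrC; apply: scale (HQ _ _ zy zx).
  - exact: scale (HQ _ _ zx zy).
  - by rewrite distrC; apply: scale (HK _ _ zy zx).
  - exact: scale (HK _ _ zx zy).
clearbody L.
have dist1 x y : ball z e x -> ball z e y -> 0 <= `|x - y| <= 1.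
  rewrite -ball_normE /= => zx zy; rewrite normr_ge0/=.
  rewrite (le_trans (ler_distD z _ _))// distrC; lra.
have zz : ball z e z by exact: ballxx.
(* Bounding [S] by its value at the centre makes the Lipschitz constant uniform on the ball. *)
have Sz y : ball z e y -> S y <= (1 + L) ^+ m * S z.
  move=> zy; apply: le_trans (compare _ _ zy zz) _; rewrite ler_wpM2r//.
  have /andP[_ d1] := dist1 _ _ zy zz.
  apply: lerXn2r; rewrite ?nnegrE ?addr_ge0 ?mulr_ge0//.
  by rewrite lerD2l ler_piMr.
have c0 : 0 <= (1 + L) ^+ m - 1 by rewrite subr_ge0 exprn_ege1// lerDl.
have half_lip x y : ball z e x -> ball z e y ->
    S x - S y <= ((1 + L) ^+ m - 1) * ((1 + L) ^+ m * S z) * `|x - y|.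
  move=> zx zy; apply: (@le_trans _ _ (((1 + L * `|x - y|) ^+ m - 1) * S y)).
    by rewrite mulrBl mul1r lerD2r compare.
  apply: (@le_trans _ _ (`|x - y| * ((1 + L) ^+ m - 1) * S y)).
    by rewrite ler_wpM2r// chord_expr_1D// dist1.
  by rewrite -mulrA mulrC ler_wpM2r// ler_wpM2l// Sz.
exists (ball z e); first exact: nbhsx_ballx.
apply: (@klipschitzW _ _ _ (((1 + L) ^+ m - 1) * ((1 + L) ^+ m * S z))); first exact: (@globally_properfilter _ _ (z, z)).
move=> [x y] [zx zy].
change (`|S x - S y| <= ((1 + L) ^+ m - 1) * ((1 + L) ^+ m * S z) * `|x - y|).
have yx := half_lip _ _ zy zx; rewrite distrC in yx.
by rewrite ler_norml (half_lip _ _ zx zy) andbT lerNl opprB.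
Unshelve. all: by end_near. Qed.
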